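(* Let $k\geq 1$, let $(X,d)$ be a compact metric space, let $T:\mathbb{Z}^k\times X\to X$ be an expansive continuous action, and let $R:\mathbb{Z}^{k-1}\times X\to X$ be a continuous action commuting with $T$, i.e. $T^v\circ R^u=R^u\circ T^v$ for all $v\in\mathbb{Z}^k$, $u\in\mathbb{Z}^{k-1}$. Then $\mathrm{mdim}(X,R)<\infty$.
   Context: A continuous action $T:\mathbb{Z}^k\times X\to X$ on a compact metric space $(X,d)$ is expansive if there is $c>0$ such that any two distinct $x,y\in X$ satisfy $\sup_{u\in\mathbb{Z}^k}d(T^ux,T^uy)>c$. Mean dimension: for an open cover $\mathcal{U}$ of $X$, its order $\mathrm{ord}(\mathcal{U})$ is the largest $n\geq 0$ such that some $n+1$ distinct members of $\mathcal{U}$ have nonempty common intersection, and $\mathrm{mesh}(\mathcal{U},\rho)$ is the supremum of the $\rho$-diameters of its members. For a metric $\rho$ and $\varepsilon>0$, $\mathrm{widim}_\varepsilon(X,\rho)$ is the minimum of $\mathrm{ord}(\mathcal{U})$ over open covers $\mathcal{U}$ with $\mathrm{mesh}(\mathcal{U},\rho)\leq\varepsilon$. For a continuous action $S$ of $\mathbb{Z}^m$ on $X$ and $\Omega\subset\mathbb{R}^m$, let $d^S_\Omega(x,y)=\sup_{u\in\Omega\cap\mathbb{Z}^m}d(S^ux,S^uy)$. The mean dimension is $\mathrm{mdim}(X,S)=\lim_{\varepsilon\to0}\lim_{N\to\infty}\mathrm{widim}_\varepsilon(X,d^S_{[-N,N]^m})/(2N+1)^m$ (for $m=0$ this equals the topological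 dimension of $X$). *)

(* Defs.v *)
From mathcomp Require Import all_boot all_order all_algebra.
From mathcomp Require Import all_classical all_reals all_analysis.
Set Implicit Arguments. Unset Strict Implicit. Unset Printing Implicit Defensive.
Import Order.TTheory GRing.Theory Num.Theory.
Local Open Scope classical_set_scope.
Local Open Scope ring_scope.

Section Defs.
Variables (R : realType) (X : Type).

Definition is_metric (d : X -> X -> R) :=
  [/\ forall x y, 0 <= d x y,
      forall x y, d x y = 0 <-> x = y,
      forall x y, d x y = d y x &
      forall x y z, d x z <= d x y + d y z].

Definition dopen (d : X -> X -> R) (A : set X) :=
  forall x, A x -> exists2 e : R, 0 < e & forall y, d x y < e -> A y.

Definition dcompact (d : X -> X -> R) :=
  forall (I : Type) (F : I -> set X), (forall i, dopen d (F i)) ->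
    (forall x, exists i, F i x) ->
    exists (n : nat) (g : 'I_n -> I), forall x, exists i, F (g i) x.

Definition dcontinuous (d : X -> X -> R) (f : X -> X) :=
  forall x (e : R), 0 < e -> exists2 r : R, 0 < r &
    forall y, d x y < r -> d (f x) (f y) < e.

Definition is_action (d : X -> X -> R) m (S : 'rV[int]_m -> X -> X) :=
  [/\ forall x, S 0 x = x,
      forall u v x, S (u + v) x = S u (S v x) &
      forall u, dcontinuous d (S u)].

Definition expansive (d : X -> X -> R) m (S : 'rV[int]_m -> X -> X) :=
  exists2 c : R, 0 < c & forall x y, x <> y ->
    (c%:E < ereal_sup [set (d (S u x) (S u y))%:E | u in [set: 'rV[int]_m]])%E.

Definition ord (U : set (set X)) : \bar R :=
  ereal_sup [set (n%:R)%:E | n in [set n : nat |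
     exists f : 'I_n.+1 -> set X, [/\ injective f, forall i, U (f i) &
        exists x, forall i, f i x]]].

Definition diam (rho : X -> X -> R) (A : set X) : \bar R :=
  ereal_sup [set (rho p.1 p.2)%:E | p in A `*` A].

Definition mesh (rho : X -> X -> R) (U : set (set X)) : \bar R :=
  ereal_sup [set diam rho A | A in U].

Definition open_cover (d : X -> X -> R) (U : set (set X)) :=
  [/\ finite_set U, forall A, U A -> dopen d A & forall x, exists2 A, U A & A x].

Definition widim (d : X -> X -> R) (eps : R) (rho : X -> X -> R) : \bar R :=
  ereal_inf [set ord U | U in [set U | open_cover d U /\ (mesh rho U <= eps%:E)%E]].

Definition box m (N : nat) : set 'rV[int]_m :=
  [set u | forall i, `|u ord0 i| <= N%:Z].

Definition dS (d : X -> X -> R) m (S : 'rV[int]_m -> X -> X) (Om : set 'rV[int]_m)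
  (x y : X) : R := sup [set d (S u x) (S u y) | u in Om].

(* mdim(X,S) = lim_{eps->0} lim_{N->oo} widim_eps(X, d^S_[-N,N]^m)/(2N+1)^m.
   The inner limit is taken as a limsup (it exists), the outer limit as a sup
   over eps > 0 (the inner quantity is nonincreasing in eps). *)
Definition mdim_eps (d : X -> X -> R) m (S : 'rV[int]_m -> X -> X) (eps : R) : \bar R :=
  limn_esup (fun N : nat =>
    (widim d eps (dS d S (@box m N)) * ((((2 * N + 1) ^ m)%N%:R)^-1)%:E)%E).

Definition mdim (d : X -> X -> R) m (S : 'rV[int]_m -> X -> X) : \bar R :=
  ereal_sup [set mdim_eps d S eps | eps in [set eps : R | 0 < eps]].

End Defs.

(* Main.v *)
(** Write [x ~_j y] when the [T]-orbits of [x] and [y] stay [c/2]-close on the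
    box of radius [j L].  Expansiveness and compactness give [L] such that
    [x ~_(j+1) y ~_(j+1) z] implies [x ~_j z]; hence a chain of [2^i] steps of
    [~_(j+i)] stays inside [~_j], while the space is covered by only
    [exp (O(q^k))] sets that are small for [~_q].  As the action [R]
    (called [S] in the lemmas) commutes with [T],
    closeness at scale [N + N M] controls the [R]-orbit over the box of radius
    [N] at scale [N], so [exp (O(N^k))] sets suffice for these orbits.

    Fix [eps] and a finite net at a fixed scale [j].  Around each net point
    there are about [2^(N-j)] nested neighbourhoods, each one [~_N]-step wider
    than the previous one.  For every [u] in the box and every net point choose
    one such neighbourhood.  A random choice makes the boundary zones rare:
    by Markov's inequality some choice leaves every [x] in at most [D] boundary
    zones (of the pullbacks by the [R^u]) as soon as
    [exp (O(N^k)) < 2^((N-j) D)], so [D = C N^(k-1)] with [C] independent of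
    [eps] is enough.  The chosen neighbourhoods cut the space into cells of
    small diameter, and thickening the cells according to the number of
    boundary zones they lie in gives a cover of order at most [D]. *)
Require Import Defs.
From mathcomp Require Import all_boot all_order all_algebra.
From mathcomp Require Import all_classical all_reals all_analysis.
From mathcomp Require Import zify lra.
Set Implicit Arguments. Unset Strict Implicit. Unset Printing Implicit Defensive.
Import Order.TTheory GRing.Theory Num.Theory.
Local Open Scope classical_set_scope.
Local Open Scope ring_scope.

(** * Rare choices by averaging *)

(** Exponential Markov inequality: give a pair [(xi, l)] the weight [#|S|] to the number of near
    indices. If every [xi] were bad, the total weight would exceed what independence of the
    coordinates allows. *)
Lemma exists_rare_choice (I S L : finType) (near : L -> I -> S -> bool) (D : nat) :
  (forall l i s s', near l i s -> near l i s' -> s = s') ->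
  (#|L| * 2 ^ #|I| < #|S| ^ D.+1)%N ->
  exists xi : {ffun I -> S},
    forall l, (#|[set i | near l i (xi i)]%SET| <= D)%N.
Proof.
move=> near1 lt_LI; apply: contrapT => /forallNP bad.
have Q0 : (0 < #|S|)%N by case: #|S| lt_LI => //; rewrite exp0n.
have weight (xi : {ffun I -> S}) l :
    (#|S| ^ #|[set i | near l i (xi i)]%SET| =
     \prod_i (if near l i (xi i) then #|S| else 1))%N.
  rewrite -big_mkcond /= -prod_nat_const.
  by apply: eq_bigl => i; rewrite inE.
suff : (#|{ffun I -> S}| * #|S| ^ D.+1 <= #|L| * (2 * #|S|) ^ #|I|)%N.
  rewrite card_ffun expnMn mulnA mulnC leq_pmul2r ?expn_gt0 ?Q0 //.
  by rewrite leqNgt lt_LI.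
apply: (@leq_trans (\sum_(xi : {ffun I -> S}) \sum_l
    #|S| ^ #|[set i | near l i (xi i)]%SET|)).
  rewrite -sum_nat_const; apply: leq_sum => xi _.
  have /existsNP[l /negP] := bad xi; rewrite -ltnNge => ltD.
  by rewrite (bigD1 l) //= (leq_trans _ (leq_addr _ _)) // leq_pexp2l.
rewrite exchange_big /= -sum_nat_const; apply: leq_sum => l _.
under eq_bigr do rewrite weight.
rewrite -(bigA_distr_bigA (fun i s => if near l i s then #|S| else 1)%N) /=.
rewrite -prod_nat_const; apply: leq_prod => i _.
(* At most one [s] is near, so each factor is at most [#|S| + #|S|]. *)
apply: (@leq_trans (\sum_s (near l i s * #|S| + 1))).
  by apply: leq_sum => s _; case: (near _ _ _); rewrite ?mul1n ?leq_addr.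
rewrite big_split /= sum1_card mul2n -addnn leq_add2r -big_distrl /=.
rewrite -[leqRHS]mul1n leq_mul2r; apply/orP; right.
have -> : (\sum_s near l i s = #|[pred s | near l i s]|)%N.
  rewrite -sum1_card [RHS]big_mkcond; apply: eq_bigr => s _.
  by rewrite inE; case: (near l i s).
by apply/card_le1_eqP => s s' /near1 => /[apply].
Qed.

(** * Covers of order at most [D] cut out by continuous functions *)

Section Cover.
Variables (R : realType) (X : Type) (d : X -> X -> R).

Definition fcontinuous (g : X -> R) :=
  forall x (e : R), 0 < e -> exists2 r : R, 0 < r &
    forall y, d x y < r -> `|g x - g y| < e.

Lemma dopen_bigcap (I : finType) (F : I -> set X) :
  (forall i, dopen d (F i)) -> dopen d [set x | forall i, F i x].
Proof.
move=> oF x Fx.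
have /choice[r rP] i : exists r : R, 0 < r /\ forall y, d x y < r -> F i y.
  by have [r r0 rP] := oF i x (Fx i); exists r.
exists (\big[Order.min/1]_i r i).
  by apply/bigmin_gtP; split=> // i _; have [] := rP i.
move=> y /bigmin_gtP[_ dxy] i; have [_] := rP i; apply; exact: dxy.
Qed.

Lemma dopen_gt (g : X -> R) (a : R) : fcontinuous g -> dopen d [set x | a < g x].
Proof.
move=> cg x /= ax; have [|r r0 rP] := cg x (g x - a); first by rewrite subr_gt0.
by exists r => // y /rP; rewrite ltr_norml => /andP[_]; rewrite ltrD2l ltrN2.
Qed.

Lemma fcontinuousN g : fcontinuous g -> fcontinuous (\- g).
Proof.
move=> cg x e e0; have [r r0 rP] := cg x e e0; exists r => // y /rP.
by rewrite /= -opprD normrN.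
Qed.

Lemma dopen_lt (g : X -> R) (a : R) : fcontinuous g -> dopen d [set x | g x < a].
Proof.
move=> /fcontinuousN/(@dopen_gt _ (- a)) og x gx.
have [|r r0 rP] := og x; first by rewrite /= ltrN2.
by exists r => // y /rP /=; rewrite ltrN2.
Qed.

Lemma dopen_norm_lt (g : X -> R) (a : R) :
  fcontinuous g -> dopen d [set x | `|g x| < a].
Proof.
move=> cg x; rewrite /= ltr_norml => /andP[gx1 gx2].
have [r r0 rP] := dopen_gt cg gx1; have [s s0 sP] := dopen_lt cg gx2.
exists (Num.min r s) => [|y]; first by rewrite lt_min r0.
by rewrite lt_min ltr_norml => /andP[/rP /= -> /sP /= ->].
Qed.

Variables (I : finType) (g : I -> X -> R) (D : nat).

Definition threshold (j : nat) : R := j.+1%:R / D.+2%:R.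

Lemma threshold_gt0 j : 0 < threshold j.
Proof. by rewrite /threshold divr_gt0. Qed.

Lemma threshold_lt j : (j <= D)%N -> threshold j < 1.
Proof. by move=> jD; rewrite /threshold ltr_pdivrMr // mul1r ltr_nat. Qed.

Lemma threshold_mono i j : (i < j)%N -> threshold i < threshold j.
Proof. by move=> ij; rewrite ltr_pM2r ?invr_gt0 // ltr_nat. Qed.

(* In direction [i], the letter [None] places the cell near [g i = 0], and
   [Some true], [Some false] on the positive, resp. negative, side of it. *)
Definition cell (j : nat) (c : {ffun I -> option bool}) : set X :=
  [set x | forall i, match c i with
    | None => `|g i x| < threshold j
    | Some true => threshold j < g i x
    | Some false => g i x < - threshold j end].

(** Tying the level [j] to the number of [None] letters leaves one possible cell per level through a
    given point; this bounds the order. *)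
Definition cells : set (set X) :=
  [set A | exists (j : 'I_D.+1) (c : {ffun I -> option bool}),
     #|[set i | c i == None]%SET| = j /\ A = cell j c].

Lemma dopen_cell j c : (forall i, fcontinuous (g i)) -> dopen d (cell j c).
Proof.
move=> cg; apply: dopen_bigcap => i; case: (c i) => [[]|].
- exact: dopen_gt.
- exact: dopen_lt.
- exact: dopen_norm_lt.
Qed.

Lemma cell_eq j (c c' : {ffun I -> option bool}) x : #|[set i | c i == None]%SET| = j ->
  #|[set i | c' i == None]%SET| = j -> cell j c x -> cell j c' x -> c = c'.
Proof.
move=> cj c'j cx c'x.
have sub i : c' i == None -> c i == None.
  move/eqP => c'i; have := c'x i; have := cx i; rewrite c'i.
  by case: (c i) => // -[]; rewrite ltr_norml => ? /andP[]; lra.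
have sub2 i : c i == None -> c' i == None.
  have /eqP e : [set i | c' i == None]%SET == [set i | c i == None]%SET.
    rewrite eqEcard cj c'j leqnn andbT.
    by apply/fintype.subsetP => k; rewrite !inE; exact: sub.
  by move: (in_setT i); have /setP/(_ i) := e; rewrite !inE => ->.
apply/ffunP => i; have := c'x i; have := cx i; have := sub i; have := sub2 i.
have := threshold_gt0 j.
case: (c i) (c' i) => [[]|] [[]|] //= t0 s2 s1 h1 h2; exfalso;
  by [clear -t0 h1 h2; lra | have := s1 isT | have := s2 isT].
Qed.

(** Take the least [j] such that at most [j] of the [|g i x|] are [<= threshold j]. By minimality at
    least [j] of them are [<= threshold j.-1], hence [< threshold j]. So exactly [j] are below, none
    equals [threshold j], and the signs of the others spell a cell. *)
Lemma cells_cover x : (#|[set i | (`|g i x| < 1)%R]%SET| <= D)%N ->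
  exists2 A, cells A & A x.
Proof.
move=> leD.
pose near j := #|[set i | `|g i x| <= threshold j]%SET|.
have exj : exists j, (near j <= j)%N.
  exists D; apply: leq_trans leD; apply: subset_leq_card.
  apply/fintype.subsetP => i; rewrite !inE => /le_lt_trans; apply.
  exact: threshold_lt.
case: (ex_minnP exj) => j nearj minj.
have jD : (j < D.+1)%N.
  rewrite ltnS; apply: minj; apply: leq_trans leD; apply: subset_leq_card.
  apply/fintype.subsetP => i; rewrite !inE => /le_lt_trans; apply.
  exact: threshold_lt.
pose lt_near := #|[set i | `|g i x| < threshold j]%SET|.
have subn : [set i | `|g i x| < threshold j]%SET
    \subset [set i | `|g i x| <= threshold j]%SET.
  by apply/fintype.subsetP => i; rewrite !inE => /ltW.
have ltj : (j <= lt_near)%N.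
  rewrite leqNgt; apply/negP => ltj.
  have j0 : (0 < j)%N by case: (j) ltj.
  have := minj j.-1; suff -> : (near j.-1 <= j.-1)%N.
    by move=> /(_ isT); rewrite leqNgt prednK // leqnn.
  rewrite -ltnS prednK //; apply: leq_ltn_trans ltj; apply: subset_leq_card.
  apply/fintype.subsetP => i; rewrite !inE => /le_lt_trans; apply.
  by apply: threshold_mono; rewrite prednK.
have /eqP eqn : [set i | `|g i x| < threshold j]%SET
    == [set i | `|g i x| <= threshold j]%SET.
  by rewrite eqEcard subn (leq_trans nearj).
pose c := [ffun i => if `|g i x| < threshold j then None else Some (0 < g i x)].
exists (cell j c); last first.
  move=> i; rewrite ffunE; case: ifPn => // nlt.
  have : ~~ (`|g i x| <= threshold j).
    by have /setP/(_ i) := eqn; rewrite !inE => <-.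
  have := threshold_gt0 j; rewrite -ltNge ltr_normr.
  case: (ltrP 0 (g i x)) => g0 t0 /orP[] h //; [| | by rewrite ltrNr];
    by exfalso; clear -g0 t0 h; lra.
exists (Ordinal jD), c; split=> //=.
rewrite (_ : [set i | c i == None]%SET = [set i | `|g i x| < threshold j]%SET).
  by apply/eqP; rewrite eqn_leq ltj andbT eqn.
by apply/setP => i; rewrite !inE ffunE; case: ifP.
Qed.

(** By [cell_eq] the level is injective on the cells through a point, and there are [D.+1]
    levels. *)
Lemma ord_cells : (ord R cells <= D%:R%:E)%E.
Proof.
apply: ge_ereal_sup => _ [n [f [injf cf [x fx]]] <-].
rewrite lee_fin ler_nat.
have /choice[j jP] i : exists j : 'I_D.+1, exists c : {ffun I -> option bool},
    #|[set k | c k == None]%SET| = j /\ f i = cell j c by have [j] := cf i; exists j.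
rewrite -ltnS -[n.+1]card_ord -[D.+1]card_ord; apply: (@leq_card _ _ j) => a b jab.
have [c [cj fa]] := jP a; have [c' [c'j fb]] := jP b.
apply: injf; rewrite fa fb jab; congr cell.
by apply: (@cell_eq (j b) _ _ x) => //; [rewrite cj jab | rewrite -jab -fa | rewrite -fb].
Qed.

Lemma finite_cells : finite_set cells.
Proof.
apply: (@sub_finite_set _ _ [set cell p.1 p.2 | p in
  [set: 'I_D.+1 * {ffun I -> option bool}]]).
  by move=> _ [j [c [_ ->]]]; exists (j, c).
exact/finite_image/finite_finset.
Qed.

(** As [threshold j < 1], the value [-1] forces the letter [Some false]. This is what will bound the
    diameter of the cells. *)
Lemma cells_side A x y i : cells A -> A x -> A y -> g i x = - 1 -> g i y < 1.
Proof.
move=> [j [c [_ ->]]] /(_ i) + /(_ i) + gx; rewrite gx.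
have := threshold_gt0 j; have := threshold_lt (ltn_ord j : (j <= D)%N).
by case: (c i) => [[]|]; rewrite ?normrN1; lra.
Qed.

End Cover.

(** * Boxes in the integer lattice *)

Lemma boxS m (M N : nat) (u : 'rV[int]_m) : (M <= N)%N -> box M u -> box N u.
Proof. by move=> MN bu i; rewrite (le_trans (bu i)) // lez_nat. Qed.

Lemma box0 m N : box N (0 : 'rV[int]_m).
Proof. by move=> i; rewrite mxE normr0. Qed.

Lemma boxD m M N (u v : 'rV[int]_m) : box M u -> box N v -> box (M + N) (u + v).
Proof.
by move=> bu bv i; rewrite mxE (le_trans (ler_normD _ _)) // PoszD lerD.
Qed.

Lemma box_exists m (u : 'rV[int]_m) : exists N, box N u.
Proof.
exists (\max_i `|u ord0 i|)%N => i; rewrite -abszE lez_nat.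
exact: (@leq_bigmax _ (fun i => `|u ord0 i|%N)).
Qed.

Lemma box_split m N (u : 'rV[int]_m) : box N.+1 u ->
  exists v w, [/\ box N v, box 1 w & u = v + w].
Proof.
(* Clamp each coordinate to [[-N, N]]; the part cut off has size at most 1. *)
move=> bu; pose v := \row_i Num.max (- N%:Z) (Num.min N%:Z (u ord0 i)).
have vE i : v ord0 i = Num.max (- N%:Z) (Num.min N%:Z (u ord0 i)) by rewrite mxE.
exists v, (u - v); split; last by rewrite addrC subrK.
- by move=> i; rewrite vE; lia.
- move=> i; have := bu i; rewrite mxE [(- v) _ _]mxE vE.
  move: (u ord0 i) => z; rewrite !ler_norml => /andP[? ?]; apply/andP.
  by rewrite /Num.max /Num.min; case: ifPn; case: ifPn; lia.
Qed.

Definition boxpt m N (f : {ffun 'I_m -> 'I_(2 * N + 1)}) : 'rV[int]_m :=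
  \row_i ((f i)%:Z - N%:Z).

Lemma box_boxpt m N (f : {ffun 'I_m -> 'I_(2 * N + 1)}) : box N (boxpt f).
Proof. by move=> i; rewrite mxE; have := ltn_ord (f i); lia. Qed.

Lemma boxptP m N (u : 'rV[int]_m) : 
  box N u -> exists f : {ffun 'I_m -> 'I_(2 * N + 1)}, u = boxpt f.
Proof.
move=> bu; have lt i : (absz (u ord0 i + N%:Z)%R < 2 * N + 1)%N.
  by have := bu i; lia.
exists [ffun i => Ordinal (lt i)]; apply/rowP => i; rewrite mxE ffunE.
rewrite abszE ger0_norm ?addrK //.
by have := bu i; rewrite ler_norml => /andP[? _]; rewrite -lerBlDr sub0r.
Qed.

(** * Compactness and uniform expansiveness *)

Section Compactness.
Variables (R : realType) (X : Type) (d : X -> X -> R).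
Hypotheses (metric_d : is_metric d) (compact_d : dcompact d).

Let distxx x : d x x = 0. Proof. by have [_ h _ _] := metric_d; apply/h. Qed.
Let distC x y : d x y = d y x. Proof. by case: metric_d. Qed.
Let dist_triangle y x z : d x z <= d x y + d y z. Proof. by case: metric_d. Qed.

Lemma compact_uniform (P : X -> nat -> Prop) :
  (forall x m n, (m <= n)%N -> P x m -> P x n) ->
  (forall x, exists n, exists2 r, 0 < r & forall y, d x y < r -> P y n) ->
  exists n, forall x, P x n.
Proof.
move=> monoP locP.
have /choice[f fP] x : exists p : nat * R,
    0 < p.2 /\ forall y, d x y < p.2 -> P y p.1.
  by have [n [r r0 rP]] := locP x; exists (n, r).
have [x y /= xy|x|n [g gP]] := compact_d (F := fun x y => d x y < (f x).2).
- exists ((f x).2 - d x y) => [|z yz]; first by rewrite subr_gt0.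
  by rewrite (le_lt_trans (dist_triangle y _ _)) // -ltrBrDl.
- by exists x; rewrite distxx; case: (fP x).
exists (\max_i (f (g i)).1) => x; have [i xi] := gP x.
apply: monoP (leq_bigmax i) _; case: (fP (g i)) => _; exact.
Qed.

Lemma compact_uniform2 (P : X -> X -> nat -> Prop) :
  (forall x y m n, (m <= n)%N -> P x y m -> P x y n) ->
  (forall x y, exists n, exists2 r, 0 < r &
     forall x' y', d x x' < r -> d y y' < r -> P x' y' n) ->
  exists n, forall x y, P x y n.
Proof.
move=> monoP locP.
have [|x|n nP] := @compact_uniform (fun x n => forall y, P x y n).
- by move=> x m n mn Pm y; exact: (monoP _ _ m).
(* The neighbourhood of [x] must serve all [y] at once, so its radius is encoded in the parameter
   [n] too. *)
- have [| |n nP] := @compact_uniform (fun y n =>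
      forall x', d x x' < n.+1%:R^-1 -> P x' y n).
  + move=> y m n mn Pm x' xx'; apply: (monoP _ _ m) => //; apply: Pm.
    by rewrite (lt_le_trans xx') // lef_pV2 ?posrE // ler_nat ltnS.
  + move=> y; have [n [r r0 rP]] := locP x y.
    have [k] := ltr_add_invr r0; rewrite add0r => kr.
    exists (maxn n k); exists r => // y' yy' x' xx'.
    apply: (monoP _ _ n); [exact: leq_maxl | apply: rP => //].
    rewrite (lt_trans _ kr) // (lt_le_trans xx') // lef_pV2 ?posrE // ler_nat.
    by rewrite ltnS leq_maxr.
  exists n; exists n.+1%:R^-1; first by rewrite invr_gt0.
  by move=> x' xx' y; apply: nP.
by exists n.
Qed.

Section Generator.
Variables (m : nat) (S : 'rV[int]_m -> X -> X) (c : R).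
Hypothesis action_S : is_action d S.
Hypothesis expansive_c : forall x y, x <> y ->
  (c%:E < ereal_sup [set (d (S u x) (S u y))%:E | u in [set: 'rV[int]_m]])%E.

(** Near the diagonal, continuity of [f] suffices. Elsewhere some time [u] separates the pair by
    more than [c], and still does so for nearby pairs, which contradicts the premise. Compactness
    bounds the times needed. *)
Lemma expansive_uniform (f : X -> X) (e : R) : dcontinuous d f -> 0 < e ->
  exists n, forall x y,
    (forall u, box n u -> d (S u x) (S u y) <= c) -> d (f x) (f y) < e.
Proof.
move=> cf e0; apply: (@compact_uniform2 (fun x y n =>
  (forall u, box n u -> d (S u x) (S u y) <= c) -> d (f x) (f y) < e)).
  by move=> x y k n kn + bn; apply=> u bu; apply: bn; exact: boxS bu.
move=> x y; have [<-|/expansive_c] := pselect (x = y).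
  have [|r r0 rP] := cf x (e / 2); first by rewrite divr_gt0.
  exists 0%N; exists r => // x' y' /rP xx' /rP xy' _.
  by rewrite (le_lt_trans (dist_triangle (f x) _ _)) // distC [e]splitr ltrD.
move=> /ereal_sup_gt[_ [u _ <-]]; rewrite lte_fin => cu.
have [n bu] := box_exists u; exists n.
(* Half of the excess over [c]: moving both points by less than [e'] keeps the distance above
   [c]. *)
pose e' := (d (S u x) (S u y) - c) / 2.
have e'0 : 0 < e' by rewrite divr_gt0 // subr_gt0.
have [_ _ cS] := action_S.
have [r r0 rP] := cS u x e' e'0; have [s s0 sP] := cS u y e' e'0.
exists (Num.min r s); first by rewrite lt_min r0.
move=> x' y'; rewrite !lt_min => /andP[/rP xx' _] /andP[_ /sP yy'] /(_ u bu).
have := dist_triangle (S u x') (S u x) (S u y).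
have := dist_triangle (S u y') (S u x') (S u y).
by rewrite (distC (S u y')); move: xx' yy'; rewrite /e'; lra.
Qed.

End Generator.
End Compactness.

(** * The largest distance along an orbit over a box *)

Section BoxDistance.
Variables (R : realType) (X : Type) (d : X -> X -> R).
Hypothesis metric_d : is_metric d.
Variables (m : nat) (S : 'rV[int]_m -> X -> X).
Hypothesis action_S : is_action d S.

Definition boxdist (N : nat) (x y : X) : R :=
  \big[Num.max/0]_(f : {ffun 'I_m -> 'I_(2 * N + 1)})
    d (S (boxpt f) x) (S (boxpt f) y).

Lemma boxdist_ge0 N x y : 0 <= boxdist N x y.
Proof. exact: bigmax_ge_id. Qed.

Lemma boxdist_ltP N x y b : 0 < b ->
  boxdist N x y < b <-> forall u, box N u -> d (S u x) (S u y) < b.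
Proof.
move=> b0; split=> [/bigmax_ltP[_ lt_b] u /boxptP[f ->]|lt_b].
  exact: lt_b.
by apply/bigmax_ltP; split=> // f _; apply: lt_b; exact: box_boxpt.
Qed.

Lemma boxdistxx N x : boxdist N x x = 0.
Proof.
apply/eqP; rewrite eq_le boxdist_ge0 andbT; apply: bigmax_le => // f _.
by case: metric_d => _ /(_ (S (boxpt f) x) (S (boxpt f) x))[_ ->].
Qed.

Lemma boxdistC N x y : boxdist N x y = boxdist N y x.
Proof. by apply: eq_bigr => f _; case: metric_d. Qed.

Lemma boxdist_triangle N y x z :
  boxdist N x z <= boxdist N x y + boxdist N y z.
Proof.
apply: bigmax_le => [|f _]; first by rewrite addr_ge0 ?boxdist_ge0.
have [_ _ _ /(_ _ (S (boxpt f) y) _)/le_trans] := metric_d; apply.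
by rewrite lerD // (@bigmax_sup _ _ _ _ f).
Qed.

Lemma boxdist_continuous N x e : 0 < e ->
  exists2 r, 0 < r & forall y, d x y < r -> boxdist N x y < e.
Proof.
move=> e0; have [_ _ cS] := action_S.
have /choice[r rP] (f : {ffun 'I_m -> 'I_(2 * N + 1)}) : exists r : R,
    0 < r /\ forall y, d x y < r -> d (S (boxpt f) x) (S (boxpt f) y) < e.
  by have [r r0 rP] := cS (boxpt f) x e e0; exists r.
exists (\big[Order.min/1]_f r f).
  by apply/bigmin_gtP; split=> // f _; have [] := rP f.
move=> y /bigmin_gtP[_ dxy]; apply/bigmax_ltP; split=> // f _.
by have [_] := rP f; apply; exact: dxy.
Qed.

End BoxDistance.

(** * Truncated distance to a set *)

Section TruncatedDistance.
Variables (R : realType) (X : Type) (e : X -> X -> R) (A : set X) (b : R).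
Hypotheses (e_ge0 : forall x y, 0 <= e x y) (exx : forall x, e x x = 0).
Hypotheses (eC : forall x y, e x y = e y x).
Hypothesis e_triangle : forall y x z, e x z <= e x y + e y z.
Hypotheses (A_neq0 : A !=set0) (b_gt0 : 0 < b).

Definition truncdist (x : X) : R := Num.min b (inf [set e y x | y in A]).

Let values_neq0 x : [set e y x | y in A] !=set0.
Proof. by have [y Ay] := A_neq0; exists (e y x), y. Qed.

Let values_lbound x : has_lbound [set e y x | y in A].
Proof. by exists 0 => _ [y _ <-]. Qed.

Lemma truncdist_eq0 x : A x -> truncdist x = 0.
Proof.
move=> Ax; apply/eqP; rewrite eq_le ge_min le_min (ltW b_gt0) /=.
apply/andP; split; last by apply: lb_le_inf => // _ [y _ <-].
by apply/orP; right; apply: ge_inf => //; exists x.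
Qed.

Lemma truncdist_lt x : truncdist x < b -> exists2 y, A y & e y x < b.
Proof.
rewrite gt_min ltxx /= => /(inf_lt (values_neq0 x))[_ [y Ay <-] yx].
by exists y.
Qed.

Lemma truncdist_le x y : truncdist y <= truncdist x + e x y.
Proof.
rewrite /truncdist -lerBlDr le_min !lerBlDr; apply/andP; split.
  by rewrite ge_min lerDl e_ge0.
rewrite -lerBlDr; apply: lb_le_inf => // _ [z Az <-]; rewrite lerBlDr.
rewrite ge_min; apply/orP; right; apply: le_trans (e_triangle x z y).
by apply: ge_inf => //; exists z.
Qed.

Lemma truncdist_lipschitz x y : `|truncdist x - truncdist y| <= e x y.
Proof.
by rewrite ler_norml; have := truncdist_le x y; have := truncdist_le y x;
  rewrite (eC y x); lra.
Qed.

End TruncatedDistance.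

(** * Chains of small steps *)

Section Reach.
Variables (X : Type) (V : nat -> X -> X -> Prop).
Hypothesis Vxx : forall n x, V n x x.
Hypothesis V_trans : forall n y x z, V n.+1 x y -> V n.+1 y z -> V n x z.

Fixpoint reach (n s : nat) (x y : X) : Prop :=
  if s is s'.+1 then exists2 z, reach n s' x z & V n z y else x = y.

Lemma reach_mono n s t x y : (s <= t)%N -> reach n s x y -> reach n t x y.
Proof.
move=> /subnK <-; elim: (t - s)%N => // k IH /IH ?.
by rewrite addSn; exists y.
Qed.

Lemma reach_split n s t x z : reach n (s + t) x z ->
  exists2 y, reach n s x y & reach n t y z.
Proof.
elim: t z => [|t IH] z; first by rewrite addn0; exists z.
by rewrite addnS => -[w /IH[y xy yw] wz]; exists y => //; exists w.
Qed.

(** Halve the chain, as in Frink's metrization lemma: by induction both halves give [V n.+1], and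
    [V_trans] joins them. *)
Lemma reach_pow2 n t s x y : (s <= 2 ^ t)%N -> reach (n + t) s x y -> V n x y.
Proof.
elim: t n s x y => [|t IH] n s x y st.
  rewrite addn0 => /(reach_mono st) /= [z ->]; exact.
move=> /(reach_mono st); rewrite expnS mul2n -addnn -addSnnS.
by move=> /reach_split[z] /IH xz /IH zy; apply: V_trans (xz _) (zy _).
Qed.

End Reach.

(** * Scales of closeness defined by the expansive action *)

Section ExpansiveScales.
Variables (R : realType) (X : Type) (d : X -> X -> R).
Hypotheses (metric_d : is_metric d) (compact_d : dcompact d).
Variables (k m : nat) (T : 'rV[int]_k -> X -> X) (S : 'rV[int]_m -> X -> X).
Hypotheses (action_T : is_action d T) (action_S : is_action d S).
Hypothesis commute_TS : forall v u x, T v (S u x) = S u (T v x).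
Variables (c : R) (L : nat).
Hypotheses (c_gt0 : 0 < c) (L_gt0 : (0 < L)%N).
Hypothesis expansive_c : forall x y, x <> y ->
  (c%:E < ereal_sup [set (d (T u x) (T u y))%:E | u in [set: 'rV[int]_k]])%E.
Hypothesis L_small : forall x y,
  (forall u, box L u -> d (T u x) (T u y) <= c) -> d x y < c / 2.

Let dist_triangle y x z : d x z <= d x y + d y z. Proof. by case: metric_d. Qed.
Let distC x y : d x y = d y x. Proof. by case: metric_d. Qed.

Definition close (j : nat) (x y : X) : Prop := boxdist d T (j * L) x y < c / 2.

Let c2_gt0 : 0 < c / 2. Proof. by rewrite divr_gt0. Qed.

Lemma closeP j x y :
  close j x y <-> forall u, box (j * L) u -> d (T u x) (T u y) < c / 2.
Proof. exact: boxdist_ltP. Qed.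

Lemma closexx j x : close j x x.
Proof. by rewrite /close boxdistxx. Qed.

Lemma closeC j x y : close j x y -> close j y x.
Proof. by rewrite /close boxdistC. Qed.

(** The triangle inequality degrades [c / 2] to [c]; [L_small] restores [c / 2] at the price of [L]
    in the radius, that is, of one scale. *)
Lemma close_trans j y x z : close j.+1 x y -> close j.+1 y z -> close j x z.
Proof.
move=> /closeP xy /closeP yz; apply/closeP => u bu; apply: L_small => v bv.
have [_ TD _] := action_T; rewrite -!TD (le_trans (dist_triangle (T (v + u) y) _ _)) //.
have bvu : box (j.+1 * L) (v + u) by rewrite mulSn; exact: boxD.
by rewrite [c]splitr lerD ?ltW ?xy ?yz.
Qed.

Lemma close_dcontinuous (f : X -> X) e : dcontinuous d f -> 0 < e ->
  exists n, forall x y, close n x y -> d (f x) (f y) < e.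
Proof.
move=> cf e0; have [n nP] := expansive_uniform metric_d compact_d action_T expansive_c cf e0.
exists n => x y /closeP xy; apply: nP => u bu.
rewrite (le_trans (ltW (xy u _))) //; first by apply: boxS bu; exact: leq_pmulr.
by rewrite ler_pdivrMr // ler_peMr ?(ltW c_gt0) // ler1n.
Qed.

Lemma closeS i j x y : (i <= j)%N -> close j x y -> close i x y.
Proof.
move=> ij /closeP xy; apply/closeP => u bu; apply: xy; apply: boxS bu.
by rewrite leq_mul2r ij orbT.
Qed.

(** Only the finitely many [S w] with [w] in the unit box need a modulus [M]. Commutation carries it
    along the whole [T]-orbit, and a vector of the box of radius [N] is a sum of [N] unit steps,
    each costing [M] scales. *)
Lemma close_commuting : exists M, forall j N x y u, box N u ->
  close (j + N * M) x y -> close j (S u x) (S u y).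
Proof.
have [_ SD cS] := action_S.
have /choice[n nP] (f : {ffun 'I_m -> 'I_(2 * 1 + 1)}) : exists n,
    forall x y, close n x y -> d (S (boxpt f) x) (S (boxpt f) y) < c / 2.
  exact: close_dcontinuous (cS _) c2_gt0.
pose M := (\max_f n f)%N; exists M.
have step j x y w : box 1 w -> close (j + M) x y -> close j (S w x) (S w y).
  move=> /boxptP[f ->] /closeP xy; apply/closeP => u bu.
  rewrite !commute_TS; apply/nP/(@closeS _ M); first exact: leq_bigmax.
  apply/closeP => v bv; have [_ TD _] := action_T; rewrite -!TD; apply: xy.
  by rewrite mulnDl addnC; exact: boxD.
move=> j N; elim: N j => [|N IH] j x y u.
  move=> bu; rewrite mul0n addn0; suff -> : u = 0 by case: action_S => S0 _ _; rewrite !S0.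
  apply/rowP => i; apply/eqP; rewrite mxE -normr_eq0 eq_le normr_ge0 andbT.
  exact: bu.
move=> /box_split[v [w [bv bw ->]]]; rewrite mulSn addnA => xy.
by rewrite addrC !SD; apply: step bw _; exact: IH xy.
Qed.

Lemma finite_net j : exists n (p : 'I_n -> X), forall x, exists i, close j (p i) x.
Proof.
have [p x px|x|n [p pP]] := compact_d (F := close j); last by exists n, p.
  have gap0 : 0 < c / 2 - boxdist d T (j * L) p x by rewrite subr_gt0.
  have [r r0 rP] := boxdist_continuous action_T (j * L) x gap0.
  exists r => // y /rP xy; rewrite /close.
  by have := boxdist_triangle metric_d T (j * L) x p y; move: xy; lra.
by exists x; exact: closexx.
Qed.

(** Code a point by the itinerary of its [T]-orbit through [a] balls of radius [c / 4]; a shared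
    code gives distances below [c / 2]. The number [a] is the same for all [q]. *)
Lemma close_cover : exists a, forall q,
  exists E : {ffun {ffun 'I_k -> 'I_(2 * (q * L) + 1)} -> 'I_a} -> set X,
    (forall x, exists l, E l x) /\ forall l x y, E l x -> E l y -> close q x y.
Proof.
have [_ TD _] := action_T.
have [p x px|x|a [p pP]] := compact_d (F := fun p => [set x | d p x < c / 4]).
- exists (c / 4 - d p x) => [|y xy]; first by rewrite subr_gt0.
  by rewrite /= (le_lt_trans (dist_triangle x _ _)) // -ltrBrDl.
- by exists x; rewrite /=; have [_ /(_ x x)[_ ->]// _ _] := metric_d; rewrite divr_gt0.
exists a => q; exists (fun l => [set x | forall f, d (p (l f)) (T (boxpt f) x) < c / 4]).
split=> [x|l x y Ex Ey].
  have /choice[l lP] (f : {ffun 'I_k -> 'I_(2 * (q * L) + 1)}) := pP (T (boxpt f) x).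
  by exists (finfun l) => f; rewrite ffunE; exact: lP.
apply/closeP => u /boxptP[f ->]; have := Ex f; have := Ey f.
by have := dist_triangle (p (l f)) (T (boxpt f) x) (T (boxpt f) y);
  rewrite (distC _ (p (l f))); lra.
Qed.

(** * Layers around net points and the resulting cover *)

Section Layers.
Variables (j t : nat).
Let N := (j.+1 + t.+1)%N.

Definition layer (p : X) (s : nat) : set X :=
  [set x | exists2 y, close j.+1 p y & reach close N s y x].

(** A continuous substitute for the indicator of the complement of the layer: the transition zone,
    where it is strictly between 0 and [c / 2], lies in [layer p s.+1] outside [layer p s]. *)
Definition depth (p : X) (s : nat) : X -> R :=
  truncdist (boxdist d T (N * L)) (layer p s) (c / 2).

Let layerS p s s' x : (s <= s')%N -> layer p s x -> layer p s' x.
Proof.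
by move=> ss' [y py yx]; exists y => //; apply: (reach_mono _ ss' yx); exact: closexx.
Qed.

Let layer_neq0 p s : layer p s !=set0.
Proof.
by exists p; apply: (@layerS _ 0) => //; exists p => //; exact: closexx.
Qed.

(** Since [N = j.+1 + t.+1], a chain of [2 ^ t.+1] steps at scale [N] collapses to one step at scale
    [j.+1]. *)
Lemma layer_sub_close p s x : (s <= 2 ^ t.+1)%N -> layer p s x -> close j p x.
Proof.
move=> st [y py yx]; apply: close_trans py _.
exact: (reach_pow2 closexx close_trans st yx).
Qed.

Lemma depth_eq0 p s x : close j.+1 p x -> depth p s x = 0.
Proof.
move=> px; apply: truncdist_eq0 => //.
- by move=> *; exact: boxdist_ge0.
- by move=> *; exact: boxdistxx.
- by apply: (@layerS _ 0) => //; exists x.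
Qed.

Lemma depth_lt p s x : depth p s x < c / 2 -> layer p s.+1 x.
Proof.
by move=> /(truncdist_lt (layer_neq0 p s))[y [z pz zy] yx]; exists z => //; exists y.
Qed.

Lemma depth_gt0 p s x : 0 < depth p s x -> ~ layer p s x.
Proof.
move=> h px; move: h; rewrite /depth truncdist_eq0 ?ltxx // => *.
  exact: boxdist_ge0.
exact: boxdistxx.
Qed.

Lemma depth_continuous p s : fcontinuous d (depth p s).
Proof.
move=> x e e0; have [r r0 rP] := boxdist_continuous action_T (N * L) x e0.
exists r => // y /rP; apply: le_lt_trans; apply: truncdist_lipschitz => //.
- by move=> *; exact: boxdist_ge0.
- by move=> *; exact: boxdistC.
- by move=> *; exact: boxdist_triangle.
Qed.

(* Two points one step apart lie in the transition zones of at most two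
   consecutive layers; keeping only the layers of even index leaves one. *)
Lemma depth_even p s s' x y : close N x y ->
  0 < depth p (2 * s) x < c / 2 -> 0 < depth p (2 * s') y < c / 2 -> s = s'.
Proof.
have le s1 s2 x1 x2 : close N x1 x2 -> 0 < depth p (2 * s1) x1 < c / 2 ->
    0 < depth p (2 * s2) x2 < c / 2 -> (s2 <= s1)%N.
  move=> x12 /andP[_ /depth_lt[z pz zx1]] /andP[/depth_gt0 nlayer _].
  rewrite leqNgt; apply/negP => lt_s; apply: nlayer.
  apply: (@layerS _ (2 * s1).+2); first by lia.
  by exists z => //; exists x1.
move=> xy hx hy; apply/eqP; rewrite eqn_leq; apply/andP; split.
  exact: le (closeC xy) hy hx.
exact: le xy hx hy.
Qed.

Variables (M a n D : nat) (p : 'I_n -> X) (eps : R).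
Hypothesis M_commuting : forall i N x y u, box N u ->
  close (i + N * M) x y -> close i (S u x) (S u y).
Hypothesis a_cover : forall q,
  exists E : {ffun {ffun 'I_k -> 'I_(2 * (q * L) + 1)} -> 'I_a} -> set X,
    (forall x, exists l, E l x) /\ forall l x y, E l x -> E l y -> close q x y.
Hypothesis p_net : forall x, exists i, close j.+1 (p i) x.
Hypothesis j_small : forall x y, close j x y -> d x y < eps / 2.
Hypothesis count_lt :
  (a ^ (2 * ((N + N * M) * L) + 1) ^ k * 2 ^ ((2 * N + 1) ^ m * n)
   < (2 ^ t) ^ D.+1)%N.

(** [exists_rare_choice] is applied to the codes at scale [N + N * M], the pairs of a time in the
    box and a net point, and the [2 ^ t] even layers; [count_lt] is its numerical condition. *)
Lemma widim_le_of_count : (widim d eps (dS d S (@box m N)) <= D%:R%:E)%E.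
Proof.
have [E [coverE closeE]] := a_cover (N + N * M).
pose I : finType := ({ffun 'I_m -> 'I_(2 * N + 1)} * 'I_n)%type.
pose zone (i : I) (s : nat) x :=
  0 < depth (p i.2) (2 * s) (S (boxpt i.1) x) < c / 2.
have [||xi xiP] := @exists_rare_choice I 'I_(2 ^ t) _
  (fun l i s => `[< exists2 x, E l x & zone i s x >]) D.
(* Two points with the same code are still [close N] after [S (boxpt i.1)], so their zones have the
   same index. *)
- move=> l i s s' /asboolP[x lx zx] /asboolP[y ly zy]; apply: val_inj.
  apply: depth_even zx zy; apply: M_commuting; first exact: box_boxpt.
  exact: closeE lx ly.
- by rewrite card_prod !card_ffun !card_ord.
(* The affine rescaling of [[0, c / 2]] to [[-1, 1]] turns the zone into [|g i x| < 1]. *)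
pose g (i : I) x := depth (p i.2) (2 * xi i) (S (boxpt i.1) x) / (c / 4) - 1.
have c4_gt0 : 0 < c / 4 by rewrite divr_gt0.
have gE i x : (`|g i x| < 1) = zone i (xi i) x.
  rewrite ltr_norml /g /zone ltrBrDr addNr ltrBlDr.
  rewrite pmulr_lgt0 ?invr_gt0 // ltr_pdivrMr //.
  by congr (_ && (_ < _)); lra.
have cg i : fcontinuous d (g i).
  move=> x e e0; have [|r r0 rP] := @depth_continuous (p i.2) (2 * xi i)
    (S (boxpt i.1) x) (e * (c / 4)); first by rewrite mulr_gt0.
  have [_ _ cS] := action_S; have [r' r'0 r'P] := cS (boxpt i.1) x r r0.
  exists r' => // y /r'P/rP; rewrite /g opprD addrACA opprK addNr addr0.
  by rewrite -mulrBl normrM normfV (gtr0_norm c4_gt0) ltr_pdivrMr.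
apply: le_trans (ord_cells g D); apply: ereal_inf_lbound; exists (cells g D) => //.
split.
  split; first exact: finite_cells.
    by move=> A [i [w [_ ->]]]; exact: dopen_cell.
  move=> x; apply: cells_cover; have [l lx] := coverE x.
  apply: leq_trans (xiP l); apply: subset_leq_card; apply/fintype.subsetP => i.
  by rewrite !inE gE => zx; exists x.
apply: ge_ereal_sup => _ [A cA <-]; apply: ge_ereal_sup => _ [[x y] [/= Ax Ay] <-].
rewrite lee_fin; apply: ge_sup; first by exists (d (S 0 x) (S 0 y)), 0 => //; exact: box0.
move=> _ [_ /boxptP[f ->] <-]; have [i pi] := p_net (S (boxpt f) x).
have px : close j (p i) (S (boxpt f) x) by apply: closeS pi.
have : g (f, i) y < 1.
  by apply: (cells_side cA Ax Ay); rewrite /g /= depth_eq0 // mul0r sub0r.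
rewrite /g ltrBlDr ltr_pdivrMr //= => lt_y.
have py : close j (p i) (S (boxpt f) y).
  (* As [xi (f, i) < 2 ^ t], the index [2 * xi (f, i) + 1] stays below [2 ^ t.+1]. *)
  apply: (@layer_sub_close _ (2 * xi (f, i)).+1).
    by have := ltn_ord (xi (f, i)); rewrite expnS; lia.
  by apply: depth_lt; move: lt_y; lra.
have := dist_triangle (p i) (S (boxpt f) x) (S (boxpt f) y).
by have := j_small px; have := j_small py; rewrite (distC _ (p i)); lra.
Qed.

End Layers.
End ExpansiveScales.

(** * Numerical estimate and conclusion *)

(** With [W = 2 * N + 1], the exponent of 2 on the left is at most a constant times [W ^ m.+1]. One
    factor [W] is absorbed by [t], which is of order [N], so [D] grows only like [W ^ m], with a
    factor free of [j] and [n]. *)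
Lemma count_bound (a n m t j M L N : nat) : N = (j.+1 + t.+1)%N -> (0 < L)%N ->
  (3 * j + 7 + n <= N)%N ->
  (a ^ (2 * ((N + N * M) * L) + 1) ^ m.+1 * 2 ^ ((2 * N + 1) ^ m * n)
   < (2 ^ t) ^ (3 * (a * ((1 + M) * L) ^ m.+1 + 1) * (2 * N + 1) ^ m).+1)%N.
Proof.
move=> NE L0 N_large; set B := ((1 + M) * L)%N; set W := (2 * N + 1)%N.
set K := (a * B ^ m.+1)%N; set P := (W ^ m)%N.
have B0 : (0 < B)%N by rewrite muln_gt0 add1n.
have le_cover : (2 * ((N + N * M) * L) + 1 <= B * W)%N.
  rewrite (_ : (N + N * M) * L = N * B)%N; last first.
    by rewrite /B mulnA mulnDr muln1.
  by rewrite /W mulnDr muln1 leq_add // mulnA [leqRHS]mulnC.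
have le_K : (a ^ (2 * ((N + N * M) * L) + 1) ^ m.+1 <= 2 ^ (K * P * W))%N.
  apply: (@leq_trans ((2 ^ a) ^ (B * W) ^ m.+1)).
    apply: (@leq_trans ((2 ^ a) ^ (2 * ((N + N * M) * L) + 1) ^ m.+1)).
      by rewrite leq_exp2r ?expn_gt0 ?addn1 // ltnW // ltn_expl.
    by rewrite leq_pexp2l ?expn_gt0 // leq_exp2r.
  by rewrite -expnM leq_exp2l // expnMn [(W ^ m.+1)%N]expnSr !mulnA.
apply: leq_ltn_trans (leq_mul le_K (leqnn _)) _.
rewrite -expnD -expnM ltn_exp2l // -/P -/K.
have t0 : (0 < t)%N by lia.
(* Here [3 * t = 3 * N - 3 * j - 6], so the bound amounts to [3 * j + 7 <= N]. *)
have t3 : (W <= 3 * t)%N by rewrite /W; lia.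
have nW : (n <= W)%N by rewrite /W; lia.
apply: (@leq_ltn_trans (K * P * W + P * W)).
  by rewrite leq_add2l leq_mul2l nW orbT.
rewrite -mulnDl mulnS (_ : (K * P + P) * W = (K + 1) * P * W)%N; last by lia.
rewrite (_ : t * (3 * (K + 1) * P) = (K + 1) * P * (3 * t))%N; last by lia.
by rewrite -[ltnLHS]add0n -addSn leq_add // leq_mul2l t3 orbT.
Qed.

Lemma limn_esup_le (R : realType) (u : nat -> \bar R) (C : \bar R) N0 :
  (forall N, (N0 <= N)%N -> (u N <= C)%E) -> (limn_esup u <= C)%E.
Proof.
move=> uC; apply: (@le_trans _ _ (ereal_sup [set u N | N in [set N | (N0 <= N)%N]])).
  apply: ereal_inf_lbound; exists [set N | (N0 <= N)%N] => //.
  exact: nbhs_infty_ge.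
by apply: ge_ereal_sup => _ [N /uC ? <-].
Qed.

Theorem theorem1p4 (R : realType) (X : Type) (d : X -> X -> R) (k : nat)
  (T : 'rV[int]_k -> X -> X) (Ract : 'rV[int]_(k.-1) -> X -> X) :
  (1 <= k)%N ->
  is_metric d -> dcompact d ->
  is_action d T -> expansive d T ->
  is_action d Ract ->
  (forall (v : 'rV[int]_k) (u : 'rV[int]_(k.-1)) (x : X), T v (Ract u x) = Ract u (T v x)) ->
  (mdim d Ract < +oo)%E.
Proof.
case: k T Ract => // m T S _ metric_d compact_d action_T [c c0 expT] action_S TS.
rewrite /= in S action_S TS *.
have c_id : dcontinuous d (fun x => x) by move=> x e e0; exists e.
have [L LP] := expansive_uniform metric_d compact_d action_T expT c_id
  (divr_gt0 c0 (ltr0Sn R 1)).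
(* Passing to [L.+1] makes the scale unit positive. *)
have L_small x y : (forall u, box L.+1 u -> d (T u x) (T u y) <= c) -> d x y < c / 2.
  by move=> cxy; apply: LP => u bu; apply: cxy; apply: boxS bu.
have [M M_commuting] := close_commuting metric_d compact_d action_T action_S
  TS c0 (ltn0Sn L) expT.
have [a a_cover] := close_cover metric_d compact_d action_T L.+1 c0.
(* [C] is fixed before [eps]: it depends only on [m], [a], [M] and [L]. *)
pose C := (3 * (a * ((1 + M) * L.+1) ^ m.+1 + 1))%N.
apply: (@le_lt_trans _ _ C%:R%:E); last exact: ltry.
apply: ge_ereal_sup => _ [eps /= eps0 <-].
have [j j_small] := close_dcontinuous metric_d compact_d action_T c0 (ltn0Sn L)
  expT c_id (divr_gt0 eps0 (ltr0Sn R 1)).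
have [n [p p_net]] := finite_net metric_d compact_d action_T L.+1 c0 j.+1.
apply: (@limn_esup_le _ _ _ (3 * j + 7 + n)) => N N_large.
pose t := (N - j.+2)%N.
have NE : N = (j.+1 + t.+1)%N by rewrite /t; lia.
have W0 : 0 < (((2 * N + 1) ^ m)%N%:R : R) by rewrite ltr0n expn_gt0 addn1.
apply: (@le_trans _ _ ((C * (2 * N + 1) ^ m)%N%:R%:E * (((2 * N + 1) ^ m)%N%:R^-1)%:E)%E).
  apply: lee_wpmul2r; first by rewrite lee_fin invr_ge0 ltW.
  have := @count_bound a n m t j M L.+1 N NE (ltn0Sn L) N_large.
  rewrite NE; exact: (widim_le_of_count metric_d action_T action_S c0 (ltn0Sn L)
    L_small M_commuting a_cover p_net j_small).
by rewrite -EFinM natrM mulfK // gt_eqF.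
Qed.
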